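(* Let $X,Y$ be topological spaces and $f:X\to Y$ a continuous map. (a) If $f$ is open, then $odL(f(X))\le odL(X)$. (b) If $f$ is closed and $X$ is $T_1$ and od-compact, then $f(X)$ (as a subspace of $Y$) is od-compact.
   Context: For a topological space $X$, $odL(X)$ is the smallest cardinal $\kappa$ such that every cover of $X$ by open dense subsets of $X$ has a subcover of cardinality $<\kappa$; $X$ is od-compact if $odL(X)\le\omega$, i.e. every cover of $X$ by open dense subsets has a finite subcover. A map is open (resp. closed) if it sends open sets to open sets (resp. closed sets to closed sets). *)

(* Defs.v *)
From HB Require Import structures.
From mathcomp Require Import all_boot all_classical.
From mathcomp Require Export topology.

Set Implicit Arguments.
Unset Strict Implicit.
Unset Printing Implicit Defensive.

Local Open Scope classical_set_scope.
Local Open Scope card_scope.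

(* The library has no type of cardinals: a cardinal is represented by a set,
   over an arbitrary type, and cardinals are compared with [#<=]. *)
Definition card_lt (T U : Type) (A : set T) (B : set U) : Prop :=
  A #<= B /\ ~ (B #<= A).

Definition open_map (X Y : topologicalType) (f : X -> Y) : Prop :=
  forall A : set X, open A -> open (f @` A).

Definition closed_map (X Y : topologicalType) (f : X -> Y) : Prop :=
  forall A : set X, closed A -> closed (f @` A).

Definition od_cover (X : topologicalType) (C : set (set X)) : Prop :=
  (forall A, C A -> open A /\ dense A) /\ \bigcup_(A in C) A = [set: X].

Definition od_bound (X : topologicalType) (U : Type) (K : set U) : Prop :=
  forall C : set (set X), od_cover C ->
    exists D : set (set X),
      [/\ D `<=` C, \bigcup_(A in D) A = [set: X] & card_lt D K].
Arguments od_bound X {U} K.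

Definition is_odL (X : topologicalType) (U : Type) (K : set U) : Prop :=
  od_bound X K /\ forall (V : Type) (K' : set V), od_bound X K' -> K #<= K'.
Arguments is_odL X {U} K.

(* A representative of the cardinal odL(X), unique up to [#=]. Representatives
   exist among the sets of subsets of [set X], see [odLP]; the default value
   [set0] is never used. *)
Definition odL (X : topologicalType) : set (set (set X)) :=
  xget set0 [set K | is_odL X K].
Arguments odL : clear implicits.

Definition od_compact (X : topologicalType) : Prop := odL X #<= [set: nat].

Lemma card_min (I : Type) (T : I -> Type) (A : forall i, set (T i)) :
  inhabited I -> exists i, forall j, A i #<= A j.
Proof.
move=> [i0].
have [[i Ai0]|Ane] := pselect (exists i, A i = set0).
  by exists i => j; rewrite Ai0 card_ge0.
have [x0 Ax0] : exists x : forall i, T i, forall i, A i (x i).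
  suff Aex i : exists a, A i a.
    by exists (fun i => projT1 (cid (Aex i))) => i; exact: projT2 (cid (Aex i)).
  have [//|/nonemptyPn Ai0] := pselect (A i !=set0).
  by case: Ane; exists i.
pose F (Z : set (forall i, T i)) := (forall x i, Z x -> A i (x i)) /\
  (forall x y i, Z x -> Z y -> x i = y i -> x = y).
have [|Z [[ZA Zinj] Zmax]] := @Zorn_bigcup _ F.
  move=> G GF Gtot; split=> [x i [Z GZ Zx]|x y i [Z GZ Zx] [Z' GZ' Zy] xy].
    exact: (GF _ GZ).1.
  by have [ZZ'|Z'Z] := Gtot _ _ GZ GZ';
    [apply: ((GF _ GZ').2 _ _ i) => //; exact: ZZ'
    |apply: ((GF _ GZ).2 _ _ i) => //; exact: Z'Z].
have [i Ai] : exists i, A i `<=` (fun x => x i) @` Z.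
  apply: contrapT => /forallNP nA.
  have aP i : exists a, A i a /\ ~ ((fun x => x i) @` Z) a.
    apply: contrapT => /forallNP h; apply: (nA i) => a Aa.
    by apply: contrapT => Za; apply: (h a).
  pose x i := projT1 (cid (aP i)).
  have xP i : A i (x i) /\ ~ ((fun y => y i) @` Z) (x i).
    exact: projT2 (cid (aP i)).
  have xZ : ~ Z x by move=> Zx; apply: (xP i0).2; exists x.
  apply: (Zmax (Z `|` [set x])); last first.
    split=> [y i [/ZA//|->]|y z i]; first exact: (xP i).1.
    move=> [Zy|->] [Zz|->] // yz; first exact: (Zinj y z i).
      by case: (xP i) => _ []; exists y.
    by case: (xP i) => _ []; exists z.
  by split; [move=> y; left|move=> h; apply: xZ; apply: h; right].
exists i => j; apply: card_le_trans (subset_card_le Ai) _.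
apply: card_le_trans (card_image_le _ _) _.
have /card_esym : (fun x : forall i, T i => x j) @` Z #= Z.
  by apply: inj_card_eq => x y /set_mem Zx /set_mem Zy; exact: Zinj.
move=> /card_eqPle[ZjZ _]; apply: card_le_trans ZjZ (subset_card_le _).
by move=> _ [x Zx <-]; exact: ZA.
Qed.

Lemma card_le_total (T U : Type) (A : set T) (B : set U) :
  A #<= B \/ B #<= A.
Proof.
pose V b := if b then T else U.
pose C b : set (V b) :=
  if b return set (V b) then A else B.
have [[] minC] := @card_min bool V C (inhabits true).
- by left; exact: (minC false).
- by right; exact: (minC true).
Qed.

Lemma card_lt_powerset (T : pointedType) (A : set T) :
  card_lt A [set: set T].
Proof.
split.
  by apply/pcard_injP; exists set1 => x y _ _ xy; rewrite -[x = y]/([set y] x) -xy.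
move=> /card_le_trans/(_ (card_leT A)) /pcard_injP[g ginj].
pose D := [set y | exists2 S, g S = y & ~ S y].
have nD : ~ D (g D).
  move=> DgD; have [S gS] := DgD; apply.
  by rewrite (ginj S D) ?inE.
by apply: (nD); exists D.
Qed.

Lemma od_bound_le (X : topologicalType) (U V : Type) (K : set U) (L : set V) :
  K #<= L -> od_bound X K -> od_bound X L.
Proof.
move=> KL bK C /bK[D [DC DX [DK nKD]]]; exists D; split=> //.
split; first exact: card_le_trans DK KL.
by move=> LD; apply: nKD; exact: card_le_trans KL LD.
Qed.

Lemma odLP (X : topologicalType) : is_odL X (odL X).
Proof.
suff [K oK] : exists K : set (set (set X)), is_odL X K.
  exact: (@xgetPex _ set0 [set K | is_odL X K] (ex_intro _ K oK)).
have bT : od_bound X [set: set (set X)].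
  by move=> C [_ CX]; exists C; split=> //; exact: card_lt_powerset.
pose I := {K : set (set (set X)) | od_bound X K}.
have [[K bK] minK] := @card_min I _ (fun K => sval K)
  (inhabits (exist _ setT bT)).
exists K; split=> // V L bL.
have [TL|LT] := card_le_total [set: set (set X)] L.
  exact: card_le_trans (minK (exist _ setT bT)) TL.
have /pcard_injP[g ginj] := LT.
have /card_eqPle[gL Lg] : g @` L #= L by exact: inj_card_eq.
exact: card_le_trans (minK (exist _ _ (od_bound_le Lg bL))) gL.
Qed.

Lemma odL_leP (X : topologicalType) (U : Type) (K : set U) :
  odL X #<= K <-> od_bound X K.
Proof.
have [bX minX] := odLP X; split; last exact: minX.
by move=> XK; exact: od_bound_le XK bX.
Qed.

Lemma od_compactP (X : topologicalType) :
  od_compact X <-> forall C : set (set X), od_cover C ->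
    exists D : set (set X),
      [/\ D `<=` C, \bigcup_(A in D) A = [set: X] & finite_set D].
Proof.
rewrite /od_compact odL_leP; split=> cX C /cX[D [DC DX Dfin]]; exists D.
  by split=> //; apply/finite_setPn; case: Dfin.
by split=> //; split; [exact: finite_set_countable|apply/finite_setPn].
Qed.

(* Main.v *)
Require Import Defs.
From mathcomp Require Import all_boot all_classical.
From mathcomp Require Import topology.

(** Both parts reduce to a continuous surjection, by corestricting [f] to its
    range. If [f] is open, preimages of dense sets are dense, so an od-cover
    pulls back, and images of the members of a subcover are again members of
    the given cover. If [f] is closed, pick [D] in the given od-cover: the
    boundary [G] of [f^-1(~D)] is closed and nowhere dense, and [f(G)] is all
    of [~D], since [f(~int f^-1(~D))] is closed and contains the dense set [D].
    Applying od-compactness to the open dense sets [f^-1(A) U ~G] yields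
    finitely many [A] covering [f(G) = ~D]. *)

Local Open Scope classical_set_scope.
Local Open Scope card_scope.

Lemma card_lt_le_trans {T U V : Type} {A : set T} {B : set U} {K : set V} :
  A #<= B -> card_lt B K -> card_lt A K.
Proof.
move=> AB [BK nKB]; split; first exact: card_le_trans AB BK.
by move=> KA; apply: nKB; exact: card_le_trans KA AB.
Qed.

(** Choosing one preimage in [C] for each element of [D] makes [D'] an image of [D], hence no
    larger, even when [h] is not injective. *)
Lemma sub_image_lift {T U : Type} {h : T -> U} {C : set T} {D : set U} :
  D `<=` h @` C -> exists D' : set T, [/\ D' `<=` C, h @` D' = D & D' #<= D].
Proof.
move=> DhC.
(* The point [x0] serves as the value of the choice function outside [D]. *)
have [[x0 _]|T0] := pselect (exists x : T, True); last first.
  exists set0; split=> //.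
  rewrite image_set0; apply/seteqP; split=> // u /DhC[x].
  by case: T0; exists x.
have /choice[s sP] u : exists x, D u -> C x /\ h x = u.
  by have [/DhC[x Cx xu]|nDu] := pselect (D u); [exists x|exists x0].
exists (s @` D); split; last exact: card_image_le.
- by move=> _ [u Du <-]; exact: (sP u Du).1.
- apply/seteqP; split=> [_ [_ [u Du <-] <-]|u Du].
    by rewrite (sP u Du).2.
  by exists (s u); [exists u|exact: (sP u Du).2].
Qed.

Lemma dense_preimage_open_map {X Y : topologicalType} {f : X -> Y} {A : set Y} :
  open_map f -> dense A -> dense (f @^-1` A).
Proof.
move=> of_ dA O [x Ox] /of_ ofO.
have [|_ [[z Oz <-] Az]] := dA _ _ ofO; first by exists (f x), x.
by exists z.
Qed.

Lemma od_bound_open_surj {X Y : topologicalType} {f : X -> Y} {U : Type}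
    {K : set U} :
  continuous f -> open_map f -> range f = [set: Y] ->
  od_bound X K -> od_bound Y K.
Proof.
move=> /continuousP cf of_ fY bX C [Cod CY].
have [|D [DC DX DK]] := bX [set f @^-1` A | A in C].
  split=> [_ [A /Cod[oA dA] <-]|].
    by split; [exact: cf|exact: dense_preimage_open_map].
  by rewrite bigcup_image -preimage_bigcup CY.
exists [set f @` B | B in D]; split.
- by move=> _ [_ /DC[A CA <-] <-]; rewrite image_preimage.
- by rewrite bigcup_image -image_bigcup DX.
- exact: card_lt_le_trans (card_image_le _ _) DK.
Qed.

Lemma closed_map_image_boundary {X Y : topologicalType} {f : X -> Y}
    {F : set Y} :
  closed_map f -> range f = [set: Y] -> dense (~` F) ->
  F `<=` f @` (f @^-1` F `\` (f @^-1` F)°).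
Proof.
move=> clf fY dF y Fy.
pose H := f @` ~` (f @^-1` F)°.
have cH : closed H by apply: (clf); exact: (open_closedC (open_interior _)).
have [x nx xy] : H y.
  apply: contrapT => nHy.
  have [|z [nHz nFz]] := dF (~` H) _ (closed_openC cH); first by exists y.
  have [x _ xz] : range f z by rewrite fY.
  by apply: nHz; exists x => // /interior_subset; rewrite /preimage/= xz.
by exists x => //; split=> //; rewrite /preimage/= xy.
Qed.

Lemma od_compact_closed_surj {X Y : topologicalType} {f : X -> Y} :
  continuous f -> closed_map f -> range f = [set: Y] ->
  od_compact X -> od_compact Y.
Proof.
move=> /continuousP cf clf fY /od_compactP cX; apply/od_compactP.
move=> C [Cod CY].
(* An empty cover offers no [D0], but is already finite. *)
have [C0|/existsNP[D0 /contrapT CD0]] := pselect (forall A, ~ C A).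
  exists C; split=> //; suff -> : C = set0 by exact: finite_set0.
  by apply/seteqP; split=> // A /C0.
have [oD0 dD0] := Cod _ CD0.
pose G := f @^-1` (~` D0) `\` (f @^-1` (~` D0))°.
have onG : open (~` G).
  rewrite /G setCD preimage_setC setCK.
  by apply: openU; [exact: cf|exact: open_interior].
have dnG : dense (~` G).
  move=> O [x Ox] oO; apply: contrapT => nOG.
  have OG z : O z -> G z.
    by move=> Oz; apply: contrapT => nGz; apply: nOG; exists z.
  (* An open set inside [G] would lie in the very interior that [G] excludes. *)
  have /(_ x Ox) : O `<=` (f @^-1` (~` D0))°.
    by rewrite -open_subsetE // => z /OG[].
  by have [] := OG x Ox.
pose h A := f @^-1` A `|` ~` G.
have [|D [/sub_image_lift[D' [D'C <- D'D]] DX Dfin]] := cX (h @` C).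
  split=> [_ [A /Cod[oA _] <-]|].
    split; first by apply: openU => //; exact: cf.
    move=> O O0 oO; have [z [Oz nGz]] := dnG O O0 oO.
    by exists z; split=> //; right.
  apply/seteqP; split=> // x _.
  have [A CA Ax] : (\bigcup_(A in C) A) (f x) by rewrite CY.
  by exists (h A); [exists A|left].
exists (D' `|` [set D0]); split.
- by move=> A [/D'C//|->].
- apply/seteqP; split=> // y _.
  have [D0y|nD0y] := pselect (D0 y); first by exists D0 => //; right.
  have dCD0 : dense (~` ~` D0) by rewrite setCK.
  have [x Gx xy] := closed_map_image_boundary clf fY dCD0 _ nD0y.
  have [_ [A D'A <-] [Ax|//]] : (\bigcup_(A in h @` D') A) x by rewrite DX.
  by exists A; [left|rewrite -xy].
- by rewrite finite_setU; split=> //; exact: card_le_finite D'D _.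
Qed.

Definition corestrict {T U : Type} (f : T -> U) (x : T) : set_type (range f) :=
  SigSub (mem_set (imageT f x)).

Lemma range_corestrict {T U : Type} (f : T -> U) :
  range (corestrict f) = [set: set_type (range f)].
Proof.
apply/seteqP; split=> // -[y yf] _; have [x _ xy] := set_mem yf.
by exists x => //; exact: val_inj.
Qed.

(** Open sets of the range are the traces of open sets of the codomain, so this form lets openness
    and closedness of images pass to the subspace. *)
Lemma image_corestrict {T U : Type} (f : T -> U) (A : set T) :
  corestrict f @` A = set_val @^-1` (f @` A).
Proof.
apply/seteqP; split=> [_ [x Ax <-]|y [x Ax xy]]; first by exists x.
by exists x => //; exact: val_inj.
Qed.

Lemma continuous_corestrict {X Y : topologicalType} {f : X -> Y} :
  continuous f -> continuous (corestrict f).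
Proof. by move=> cf; exact: (@continuous_comp_initial _ _ _ set_val). Qed.

Lemma open_map_corestrict {X Y : topologicalType} {f : X -> Y} :
  open_map f -> open_map (corestrict f).
Proof. by move=> of_ A /of_ oA; rewrite image_corestrict; exists (f @` A). Qed.

Lemma closed_map_corestrict {X Y : topologicalType} {f : X -> Y} :
  closed_map f -> closed_map (corestrict f).
Proof.
move=> clf A /clf cA; rewrite image_corestrict.
by rewrite -openC; exists (~` (f @` A)) => //; exact: closed_openC.
Qed.

Theorem lemma6p2 (X Y : topologicalType) (f : X -> Y) (hf : continuous f) :
  (open_map f -> odL (set_type (range f)) #<= odL X) /\
  (closed_map f -> accessible_space X -> od_compact X ->
     od_compact (set_type (range f))).
Proof.
have cf := continuous_corestrict hf; have rf := range_corestrict f.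
split=> [of_|clf _].
  apply/odL_leP; apply: od_bound_open_surj cf (open_map_corestrict of_) rf _.
  exact: (odLP X).1.
exact: od_compact_closed_surj cf (closed_map_corestrict clf) rf.
Qed.
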